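(* For every integer $n\ge 1$ the following identities hold: (i) $\tau(n) = -\frac{11}{24} n\sigma_9(n) + \frac{35}{24} n\sigma_5(n) + 350\sum_{m=1}^{n-1}(n-m)\sigma_3(m)\sigma_5(n-m)$; (ii) $\tau(n) = \frac{11}{36} n\sigma_9(n) + \frac{25}{36} n\sigma_3(n)- 350\sum_{m=1}^{n-1}m\sigma_3(m)\sigma_5(n-m)$; (iii) $\tau(n) = \frac{1}{6} n\sigma_9(n) + \frac{5}{6} n\sigma_3(n) - \frac{420}{n}\sum_{m=1}^{n-1}m^2\sigma_3(m)\sigma_5(n-m)$; (iv) $\tau(n) = n\sigma_9(n) - \frac{2100}{n}\sum_{m=1}^{n-1}m(n-m)\sigma_3(m)\sigma_5(n-m)$; (v) $\tau(n) = -\frac{1}{4} n\sigma_9(n) + \frac{5}{4} n\sigma_5(n) + \frac{300}{n}\sum_{m=1}^{n-1}(n-m)^2\sigma_3(m)\sigma_5(n-m)$.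
   Context: $\tau(n)$ is Ramanujan's tau function, defined by $q\prod_{n\ge 1}(1-q^n)^{24} = \sum_{n\ge 1}\tau(n)q^n$. For $k\ge 1$, $\sigma_k(n)=\sum_{d\mid n} d^k$ (sum over positive divisors of $n$). For $n=1$ the sum $\sum_{m=1}^{n-1}$ is empty and equals $0$. *)

(* Defs.v *)
From HB Require Import structures.
From mathcomp Require Import all_boot all_order all_algebra.

Set Implicit Arguments.
Unset Strict Implicit.
Unset Printing Implicit Defensive.

Import GRing.Theory.
Local Open Scope ring_scope.

(* The partial product q (1 - q)^24 ... (1 - q^N)^24, with q = 'X. *)
Definition delta_partial (N : nat) : {poly int} :=
  'X * \prod_(1 <= m < N.+1) (1 - 'X^m) ^+ 24.

(* MathComp has no formal power series: the coefficient of q^n in the formal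
   infinite product is the eventual value of the coefficients of q^n in the
   partial products. It is reached at N = n, as shown by tau_delta_partial. *)
Definition tau (n : nat) : int := (delta_partial n)`_n.

Definition sigma (k n : nat) : nat := (\sum_(d <- divisors n) d ^ k)%N.

Lemma delta_partialS (N : nat) :
  delta_partial N.+1 = delta_partial N * (1 - 'X^(N.+1)) ^+ 24.
Proof. by rewrite /delta_partial big_nat_recr //= mulrA. Qed.

Lemma coef_mul_1subXn (p : {poly int}) (M n j : nat) :
  (n < M)%N -> (p * (1 - 'X^M) ^+ j)`_n = p`_n.
Proof.
move=> nM; elim: j p => [|j IHj] p; first by rewrite expr0 mulr1.
by rewrite exprS mulrA IHj mulrBr mulr1 coefB coefMXn nM subr0.
Qed.

Lemma tau_delta_partial (n N : nat) :
  (n <= N)%N -> (delta_partial N)`_n = tau n.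
Proof.
move=> /subnKC <-; elim: (N - n)%N => [|k IHk]; first by rewrite addn0.
by rewrite addnS delta_partialS coef_mul_1subXn ?ltnS ?leq_addr.
Qed.

(* Main.v *)
Require Import Defs.
From mathcomp Require Import all_boot all_order all_algebra.
From mathcomp Require Import zify ring lra.

(* With P, Q, R the Eisenstein series of weights 2, 4, 6 and D = q d/dq, the
   identities are linear combinations of coefficients of
     QR = E_10,   2 Q DR - 3 R DQ = -(Q^3 - R^2) = -1728 Delta,
     10 Q D^2 R - 35 DQ DR + 21 R D^2 Q = 0
   and of their derivatives. The last two follow formally from Ramanujan's
   system 12 DP = P^2 - Q, 3 DQ = PQ - R, 2 DR = PR - Q^2, which also gives
   D(Q^3 - R^2) = P (Q^3 - R^2); since D Delta = P Delta for the product Delta,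
   both solve the same first order equation, hence are proportional.

   Ramanujan's system and QR = E_10 are convolution identities for sigma_k. Each
   is an instance, for a suitable polynomial g, of a formula of Skoruppa type
   for the sum over a x + b y = n of
     g(a,b) - g(a,-b) + g(a,a-b) - g(a,a+b) + g(b-a,b) - g(a+b,b):
   the substitutions (a,x,b,y) -> (a,x-y,a+b,y), for y < x, and its mirror image
   make everything cancel except the terms with a = b or x = y. *)

Set Implicit Arguments.
Unset Strict Implicit.
Unset Printing Implicit Defensive.

Import GRing.Theory Num.Theory.
Local Open Scope ring_scope.

(** * Sums over the decompositions of n as a x + b y *)

Lemma big_bij_seq (R : Type) (idx : R) (op : Monoid.com_law idx)
    (T T' : eqType) (s : seq T) (s' : seq T') (P : pred T) (Q : pred T')
    (h : T -> T') (h' : T' -> T) (F : T' -> R) :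
    uniq s -> uniq s' ->
    (forall t, t \in s -> P t -> [/\ h t \in s', Q (h t) & h' (h t) = t]) ->
    (forall t, t \in s' -> Q t -> [/\ h' t \in s, P (h' t) & h (h' t) = t]) ->
  \big[op/idx]_(t <- s | P t) F (h t) = \big[op/idx]_(t <- s' | Q t) F t.
Proof.
move=> us us' hP h'P; rewrite -big_filter -[RHS]big_filter -(big_map h xpredT).
apply/perm_big/uniq_perm; rewrite ?filter_uniq //.
  rewrite map_inj_in_uniq ?filter_uniq // => t u.
  rewrite !mem_filter => /andP[Pt ts] /andP[Pu us''] eq_h.
  by have [_ _ <-] := hP t ts Pt; have [_ _ <-] := hP u us'' Pu; rewrite eq_h.
move=> t; rewrite mem_filter; apply/mapP/andP.
  by case=> u; rewrite mem_filter => /andP[Pu us''] ->; have [] := hP u us'' Pu.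
case=> Qt ts; have [h's Ph' h'K] := h'P t ts Qt.
by exists (h' t); rewrite ?mem_filter ?Ph'.
Qed.

Arguments big_bij_seq {R idx op T T' s s' P Q} h h' F.

Local Notation quad := ((nat * nat) * (nat * nat))%type.

(* The quadruple ((a, x), (b, y)) stands for the decomposition n = a x + b y
   into positive integers. *)
Definition quads (n : nat) : seq quad :=
  let pairs := [seq (a, x) | a <- iota 1 n, x <- iota 1 n] in
  [seq t <- [seq (u, v) | u <- pairs, v <- pairs]
     | (t.1.1 * t.1.2 + t.2.1 * t.2.2 == n)%N].

Lemma quads_uniq n : uniq (quads n).
Proof.
apply/filter_uniq/allpairs_uniq; last by case=> [? ?] [? ?].
  by apply/allpairs_uniq; rewrite ?iota_uniq // => -[? ?] [? ?].
by apply/allpairs_uniq; rewrite ?iota_uniq // => -[? ?] [? ?].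
Qed.

Lemma mem_pairs (T U : eqType) (s : seq T) (r : seq U) u v :
  ((u, v) \in [seq (a, b) | a <- s, b <- r]) = (u \in s) && (v \in r).
Proof.
apply/allpairsP/andP => [[[a b] /= [? ? [-> ->]]] //|[? ?]].
by exists (u, v).
Qed.

Lemma mem_quads n a x b y :
  (((a, x), (b, y)) \in quads n) =
  [&& 0 < a, 0 < x, 0 < b, 0 < y & a * x + b * y == n]%N.
Proof.
rewrite /quads mem_filter !mem_pairs !mem_iota /=.
apply/idP/idP; first by lia.
case/and5P=> a0 x0 b0 y0 /eqP nE.
have ? : (a <= a * x)%N by rewrite leq_pmulr.
have ? : (x <= a * x)%N by rewrite leq_pmull.
have ? : (b <= b * y)%N by rewrite leq_pmulr.
have ? : (y <= b * y)%N by rewrite leq_pmull.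
by rewrite nE eqxx; lia.
Qed.

Section QuadSums.

Variables (V : nmodType) (n : nat).
Implicit Type F : nat -> nat -> V.

Lemma quads_swap (P : rel nat) F :
  \sum_(t <- quads n | P t.1.2 t.2.2) F t.1.1 t.2.1 =
  \sum_(t <- quads n | P t.2.2 t.1.2) F t.2.1 t.1.1.
Proof.
pose sw (t : quad) := (t.2, t.1).
apply: (big_bij_seq sw sw (fun t => F t.2.1 t.1.1));
  rewrite ?quads_uniq // => -[[a x] [b y]] /=; rewrite !mem_quads => H ?;
  split=> //; lia.
Qed.

Lemma quads_swap_num (P : rel nat) F :
  \sum_(t <- quads n | P t.1.1 t.2.1) F t.1.1 t.2.1 =
  \sum_(t <- quads n | P t.2.1 t.1.1) F t.2.1 t.1.1.
Proof.
pose sw (t : quad) := (t.2, t.1).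
apply: (big_bij_seq sw sw (fun t => F t.2.1 t.1.1));
  rewrite ?quads_uniq // => -[[a x] [b y]] /=; rewrite !mem_quads => H ?;
  split=> //; lia.
Qed.

(** The map [h] preserves n because a (x - y) + (a + b) y = a x + b y; it sends the region y < x
    onto a < b, and the old b is the new b minus a. *)
Lemma quads_shear F :
  \sum_(t <- quads n | (t.2.2 < t.1.2)%N) F t.1.1 t.2.1 =
  \sum_(t <- quads n | (t.1.1 < t.2.1)%N) F t.1.1 (t.2.1 - t.1.1)%N.
Proof.
pose h (t : quad) :=
  ((t.1.1, t.1.2 - t.2.2), (t.1.1 + t.2.1, t.2.2))%N.
pose h' (t : quad) :=
  ((t.1.1, t.1.2 + t.2.2), (t.2.1 - t.1.1, t.2.2))%N.
transitivity (\sum_(t <- quads n | (t.2.2 < t.1.2)%N)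
    F (h t).1.1 ((h t).2.1 - (h t).1.1)%N).
  by apply: eq_bigr => -[[a x] [b y]] _ /=; rewrite addKn.
apply: (big_bij_seq h h' (fun t => F t.1.1 (t.2.1 - t.1.1)%N));
  rewrite ?quads_uniq //.
- move=> [[a x] [b y]]; rewrite !mem_quads /= => H lt_yx.
  split; [|by lia|by rewrite /h' /= subnK ?addKn // ltnW].
  have -> : (a * (x - y) + (a + b) * y = a * x + b * y)%N by nia.
  by lia.
move=> [[a x] [b y]]; rewrite !mem_quads /= => H lt_ab.
split; [|by lia|by rewrite /h /= addnK subnKC // ltnW].
have -> : (a * (x + y) + (b - a) * y = a * x + b * y)%N by nia.
by lia.
Qed.

Lemma quads_shear_sym F :
  \sum_(t <- quads n | (t.1.2 < t.2.2)%N) F t.1.1 t.2.1 =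
  \sum_(t <- quads n | (t.2.1 < t.1.1)%N) F (t.1.1 - t.2.1)%N t.2.1.
Proof.
rewrite (quads_swap ltn) (quads_shear (fun a b => F b a)).
by rewrite (quads_swap_num ltn (fun a b => F (b - a)%N a)).
Qed.

Lemma quads_trichotomy (u v : quad -> nat) (F : quad -> V) :
  \sum_(t <- quads n) F t =
  \sum_(t <- quads n | (v t < u t)%N) F t +
  \sum_(t <- quads n | u t == v t) F t +
  \sum_(t <- quads n | (u t < v t)%N) F t.
Proof.
rewrite (bigID (fun t => v t < u t)%N) /= -addrA; congr (_ + _).
rewrite (bigID (fun t => u t == v t)) /=.
by congr (_ + _); apply: eq_bigl => t; lia.
Qed.

Lemma quads_trichotomy_num F :
  \sum_(t <- quads n) F t.1.1 t.2.1 =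
  \sum_(t <- quads n | (t.2.1 < t.1.1)%N) F t.1.1 t.2.1 +
  \sum_(t <- quads n | t.1.1 == t.2.1) F t.1.1 t.1.1 +
  \sum_(t <- quads n | (t.1.1 < t.2.1)%N) F t.1.1 t.2.1.
Proof.
rewrite (quads_trichotomy (fun t => t.1.1) (fun t => t.2.1)).
by congr (_ + _ + _); apply: eq_bigr => t /eqP <-.
Qed.

Lemma quads_trichotomy_shear F :
  \sum_(t <- quads n) F t.1.1 t.2.1 =
  \sum_(t <- quads n | (t.1.1 < t.2.1)%N) F t.1.1 (t.2.1 - t.1.1)%N +
  \sum_(t <- quads n | t.1.2 == t.2.2) F t.1.1 t.2.1 +
  \sum_(t <- quads n | (t.2.1 < t.1.1)%N) F (t.1.1 - t.2.1)%N t.2.1.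
Proof.
rewrite (quads_trichotomy (fun t => t.1.2) (fun t => t.2.2)).
by rewrite quads_shear quads_shear_sym.
Qed.

(** If x = y then n = (a + b) x: the divisor d = a + b of n fixes x = n / d, and a ranges freely
    below d. *)
Lemma quads_diag_cofactor F : (0 < n)%N ->
  \sum_(t <- quads n | t.1.2 == t.2.2) F t.1.1 t.2.1 =
  \sum_(d <- divisors n) \sum_(1 <= a < d) F a (d - a)%N.
Proof.
move=> n_gt0.
pose s := [seq (d, a) | d <- divisors n, a <- index_iota 1 d].
pose h (t : quad) := (t.1.1 + t.2.1, t.1.1)%N.
pose h' (u : nat * nat) := ((u.2, n %/ u.1), (u.1 - u.2, n %/ u.1))%N.
have mem_s d a : ((d, a) \in s) = [&& 0 < a, a < d & d %| n]%N.
  apply/allpairsPdep/and3P => [[d' [a' [d'n]]]|[a0 ad dn]].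
    by rewrite mem_index_iota -dvdn_divisors // in d'n * => /andP[? ?] [-> ->].
  by exists d, a; rewrite -dvdn_divisors // mem_index_iota a0 ad.
transitivity (\sum_(u <- s) F u.2 (u.1 - u.2)%N); last first.
  by rewrite big_allpairs_dep.
transitivity (\sum_(t <- quads n | t.1.2 == t.2.2)
    F (h t).2 ((h t).1 - (h t).2)%N).
  by apply: eq_bigr => -[[a x] [b y]] _ /=; rewrite addKn.
apply: (big_bij_seq h h' (fun u => F u.2 (u.1 - u.2)%N));
  rewrite ?quads_uniq //.
- apply: allpairs_uniq_dep => [|d _|[d a] [d' a'] _ _ /= [-> ->] //].
    exact: divisors_uniq.
  exact: iota_uniq.
- move=> [[a x] [b y]]; rewrite mem_quads /= => /and5P[a0 x0 b0 y0 /eqP nE].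
  move=> /eqP exy; rewrite -{}exy -mulnDl in nE *; split=> //.
    by rewrite mem_s a0 -nE dvdn_mulr ?andbT // -[ltnLHS]addn0 ltn_add2l.
  by rewrite /h' /= -nE addKn mulKn // addn_gt0 a0.
move=> [d a]; rewrite mem_s => /and3P[a0 ad dn] _; rewrite /h /h' /=.
have le_dn := dvdn_leq n_gt0 dn; have d0 := leq_ltn_trans (leq0n a) ad.
split=> //; last by rewrite subnKC // ltnW.
rewrite mem_quads a0 subn_gt0 ad divn_gt0 // le_dn /=.
by rewrite -mulnDl subnKC ?(ltnW ad) // mulnC divnK.
Qed.

(** Exchanging numbers with cofactors turns a = b into x = y; the summand then depends only on d = a
    + b, which arises from d - 1 values of a. *)
Lemma quads_diag_num (F : nat -> V) : (0 < n)%N ->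
  \sum_(t <- quads n | t.1.1 == t.2.1) F t.1.1 =
  \sum_(d <- divisors n) F (n %/ d)%N *+ d.-1.
Proof.
move=> n_gt0.
pose tr (t : quad) := ((t.1.2, t.1.1), (t.2.2, t.2.1)).
transitivity (\sum_(t <- quads n | t.1.2 == t.2.2) F t.1.2).
  apply: (big_bij_seq tr tr (fun t => F t.1.2)); rewrite ?quads_uniq //;
    move=> [[a x] [b y]]; rewrite !mem_quads /= => H e; split=> //; lia.
transitivity (\sum_(t <- quads n | t.1.2 == t.2.2)
    F (n %/ (t.1.1 + t.2.1))%N).
  rewrite big_seq_cond [RHS]big_seq_cond; apply: eq_bigr => -[[a x] [b y]] /=.
  rewrite mem_quads => /andP[/and5P[a0 x0 b0 y0 /eqP <-] /eqP <-].
  by rewrite -mulnDl mulKn // addn_gt0 a0.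
rewrite (quads_diag_cofactor (fun a b => F (n %/ (a + b))%N)) //.
apply: eq_bigr => d _; rewrite (eq_big_nat _ _ (F2 := fun=> F (n %/ d)%N)).
  by rewrite sumr_const_nat subn1.
by move=> a /andP[_ ad]; rewrite subnKC // ltnW.
Qed.

End QuadSums.

(** Grouping by m = a x: a is then any divisor of m, b any divisor of n - m, and the cofactors are
    determined. *)
Lemma quads_conv (R : pzSemiRingType) (n : nat) (f g : nat -> R) :
  \sum_(t <- quads n) f t.1.1 * g t.2.1 =
  \sum_(1 <= m < n) (\sum_(d <- divisors m) f d) *
                      (\sum_(d <- divisors (n - m)) g d).
Proof.
pose s := [seq (m, p) | m <- index_iota 1 n,
  p <- [seq (d, e) | d <- divisors m, e <- divisors (n - m)]].
pose h (t : quad) := (t.1.1 * t.1.2, (t.1.1, t.2.1))%N.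
pose h' (u : nat * (nat * nat)) :=
  ((u.2.1, u.1 %/ u.2.1), (u.2.2, (n - u.1) %/ u.2.2))%N.
have mem_s m d e : ((m, (d, e)) \in s) =
    [&& 0 < m, m < n, d %| m & e %| n - m]%N.
  apply/allpairsPdep/and4P => [[m' [p [m'n pn [em ep]]]]|[m0 mn dm en]].
    move: m'n pn; rewrite -em -ep mem_index_iota => /andP[m0 mn].
    by rewrite mem_pairs -!dvdn_divisors ?subn_gt0 // m0 mn => /andP[].
  exists m, (d, e); rewrite mem_index_iota m0 mn mem_pairs.
  by rewrite -!dvdn_divisors ?subn_gt0 // dm.
transitivity (\sum_(u <- s) f u.2.1 * g u.2.2); last first.
  rewrite big_allpairs_dep; apply: eq_bigr => m _.
  by rewrite big_allpairs big_distrlr.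
apply: (big_bij_seq h h' (fun u => f u.2.1 * g u.2.2)); rewrite ?quads_uniq //.
- apply: allpairs_uniq_dep => [|m _|[m p] [m' p'] _ _ /= [-> ->] //].
    exact: iota_uniq.
  by apply: allpairs_uniq; rewrite ?divisors_uniq // => -[? ?] [? ?].
- move=> [[a x] [b y]]; rewrite mem_quads /= => /and5P[a0 x0 b0 y0 /eqP nE] _.
  rewrite /h' /h /= -nE addKn !mulKn //; split=> //.
  rewrite mem_s -nE addKn !dvdn_mulr // muln_gt0 a0 x0 -[ltnLHS]addn0.
  by rewrite ltn_add2l muln_gt0 b0 y0.
move=> [m [d e]]; rewrite mem_s => /and4P[m0 mn dm en] _; rewrite /h /h' /=.
have nm0 : (0 < n - m)%N by rewrite subn_gt0.
have d0 := dvdn_gt0 m0 dm; have e0 := dvdn_gt0 nm0 en.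
have mE : (d * (m %/ d) = m)%N by rewrite mulnC divnK.
have nE : (e * ((n - m) %/ e) = n - m)%N by rewrite mulnC divnK.
split=> //; last by rewrite mE.
rewrite mem_quads d0 e0 !divn_gt0 // (dvdn_leq m0 dm) (dvdn_leq nm0 en) /=.
by rewrite mE nE subnKC // ltnW.
Qed.

(** * The Skoruppa type summation formula *)

Lemma quads_even_sum (g : rat -> rat -> rat) (n : nat) : (0 < n)%N ->
    (forall a b, g (- a) (- b) = g a b) ->
  let G a b := g a b - g a (- b) + g a (a - b) - g a (a + b)
               + g (b - a) b - g (a + b) b in
  let h a := g a a + g 0 a + g a 0 in
  let k d a := g a (a - d) + g a d + g d (d - a) in
  \sum_(t <- quads n) G t.1.1%:R t.2.1%:R =
  \sum_(d <- divisors n) (h (n %/ d)%:R *+ d.-1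
                          - \sum_(1 <= a < d) k d%:R a%:R).
Proof.
move=> n_gt0 g_even G h k.
pose L (f : rat -> rat -> rat) :=
  \sum_(t <- quads n | (t.1.1 < t.2.1)%N) f t.1.1%:R t.2.1%:R.
pose U (f : rat -> rat -> rat) :=
  \sum_(t <- quads n | (t.2.1 < t.1.1)%N) f t.1.1%:R t.2.1%:R.
pose X (f : rat -> rat -> rat) :=
  \sum_(t <- quads n | t.1.2 == t.2.2) f t.1.1%:R t.2.1%:R.
pose Y (f : rat -> rat) := \sum_(t <- quads n | t.1.1 == t.2.1) f t.1.1%:R.
pose S (f : rat -> rat -> rat) := \sum_(t <- quads n) f t.1.1%:R t.2.1%:R.
have shear (f : rat -> rat -> rat) :
    S f = L (fun a b => f a (b - a)) + X f + U (fun a b => f (a - b) b).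
  rewrite /S (quads_trichotomy_shear n (fun a b => f a%:R b%:R)).
  by congr (_ + _ + _); apply: eq_bigr => t lt_t; rewrite natrB // ltnW.
have num (f : rat -> rat -> rat) : S f = U f + Y (fun a => f a a) + L f.
  exact: (quads_trichotomy_num n (fun a b => f a%:R b%:R)).
have diag (f : rat -> rat -> rat) :
    X f = \sum_(d <- divisors n) \sum_(1 <= a < d) f a%:R (d - a)%:R.
  exact: (quads_diag_cofactor (fun a b => f a%:R b%:R) n_gt0).
have swap (f : rat -> rat -> rat) : L f = U (fun a b => f b a).
  exact: (quads_swap_num n ltn (fun a b => f a%:R b%:R)).
have -> : \sum_(t <- quads n) G t.1.1%:R t.2.1%:R =
    S g - S (fun a b => g a (- b)) + S (fun a b => g a (a - b))
    - S (fun a b => g a (a + b)) + S (fun a b => g (b - a) b)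
    - S (fun a b => g (a + b) b).
  by rewrite /S -!(sumrB, big_split).
rewrite sumrB -(quads_diag_num (fun a => h a%:R)) //.
(* The three terms with a minus sign are split by x and y, the other three by a and b. The
   off-diagonal pieces then match in pairs, up to [swap] and one use of [g_even]; [h] collects the
   pieces with a = b, and [k] those with x = y, where d = a + b. *)
rewrite (shear (fun a b => g a (- b))) (shear (fun a b => g a (a + b))).
rewrite (shear (fun a b => g (a + b) b)) /=.
rewrite (num g) (num (fun a b => g a (a - b))) (num (fun a b => g (b - a) b)).
have extL f f' : (forall a b, f a b = f' a b) -> L f = L f'.
  by move=> eq_f; apply: eq_bigr.
have extU f f' : (forall a b, f a b = f' a b) -> U f = U f'.
  by move=> eq_f; apply: eq_bigr.
have -> : L (fun a b => g a (- (b - a))) = L (fun a b => g a (a - b)).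
  by apply: extL => a b; rewrite opprB.
have -> : L (fun a b => g a (a + (b - a))) = L g.
  by apply: extL => a b; rewrite addrC subrK.
have -> : L (fun a b => g (a + (b - a)) (b - a)) = L (fun a b => g b (b - a)).
  by apply: extL => a b; rewrite addrC subrK.
have -> : U (fun a b => g (a - b) (a - b + b)) = U (fun a b => g (a - b) a).
  by apply: extU => a b; rewrite subrK.
have -> : U (fun a b => g (a - b + b) b) = U g.
  by apply: extU => a b; rewrite subrK.
have -> : U (fun a b => g (b - a) b) = U (fun a b => g (a - b) (- b)).
  by apply: extU => a b; rewrite -g_even opprB.
rewrite (swap (fun a b => g (b - a) b)) (swap (fun a b => g b (b - a))).
have -> : \sum_(d <- divisors n) \sum_(1 <= a < d) k d%:R a%:R =
    X (fun a b => g a (- b)) + X (fun a b => g a (a + b))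
    + X (fun a b => g (a + b) b).
  rewrite !diag -!big_split; apply: eq_bigr => d _ /=.
  rewrite -!big_split /=; apply: eq_big_nat => a /andP[_ ad].
  by rewrite /k natrB ?(ltnW ad) // opprB [_ + (_ - _)]addrC subrK.
have -> : Y (fun a => g a (a - a)) = Y (fun a => g a 0).
  by apply: eq_bigr => t _; rewrite subrr.
have -> : Y (fun a => g (a - a) a) = Y (fun a => g 0 a).
  by apply: eq_bigr => t _; rewrite subrr.
have -> : \sum_(t <- quads n | t.1.1 == t.2.1) h t.1.1%:R =
    Y (fun a => g a a) + Y (fun a => g 0 a) + Y (fun a => g a 0).
  by rewrite /Y -!big_split.
ring.
Qed.

(** * Divisor sums and their convolutions *)

Definition sigmaQ (k n : nat) : rat := (sigma k n)%:R.

Lemma sigmaQE k n : sigmaQ k n = \sum_(d <- divisors n) d%:R ^+ k.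
Proof. by rewrite /sigmaQ /sigma natr_sum; under eq_bigr do rewrite natrX. Qed.

Definition sigma_conv (i j n : nat) : rat :=
  \sum_(1 <= m < n) sigmaQ i m * sigmaQ j (n - m).

Lemma sigma_conv_quads i j n :
  sigma_conv i j n = \sum_(t <- quads n) t.1.1%:R ^+ i * t.2.1%:R ^+ j.
Proof.
rewrite (quads_conv n (fun a => a%:R ^+ i : rat) (fun b => b%:R ^+ j)).
by apply: eq_bigr => m _; rewrite !sigmaQE.
Qed.

Lemma sigma_convC i j n : sigma_conv i j n = sigma_conv j i n.
Proof.
rewrite /sigma_conv big_nat_rev [LHS]big_nat [RHS]big_nat.
apply: eq_bigr => m /andP[m_gt0 mn].
by rewrite add1n subSS subKn ?(ltnW mn) // mulrC.
Qed.

Lemma sum_divisors_rev (V : nmodType) n (F : nat -> V) : (0 < n)%N ->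
  \sum_(d <- divisors n) F (n %/ d)%N = \sum_(d <- divisors n) F d.
Proof.
move=> n_gt0; pose h d := (n %/ d)%N.
apply: (big_bij_seq h h F); rewrite ?divisors_uniq // => d;
  rewrite -!dvdn_divisors // => dn _;
  by rewrite /h divnA // mulKn // dvdn_div.
Qed.

Lemma sum_codivisor_pow k n : (0 < n)%N ->
  \sum_(d <- divisors n) (n %/ d)%:R ^+ k.+1 *+ d.-1 =
  n%:R * sigmaQ k n - sigmaQ k.+1 n.
Proof.
move=> n_gt0; rewrite !sigmaQE mulr_sumr -sumrB.
rewrite -[RHS]sum_divisors_rev // [LHS]big_seq [RHS]big_seq.
apply: eq_bigr => d; rewrite -dvdn_divisors // => dn.
have d_gt0 := dvdn_gt0 n_gt0 dn.
rewrite -mulr_natl -subn1 natrB // -{2}(divnK dn) natrM exprS; ring.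
Qed.

(** With Bernoulli polynomials B_j, this is (B_(k+1)(x) - B_(k+1)(0)) / (k+1) for k up to 7; the
    default branch stands for k = 7. *)
Definition power_sum (k : nat) (x : rat) : rat :=
  match k with
  | 0 => x
  | 1 => x ^+ 2 / 2 - x / 2
  | 2 => x ^+ 3 / 3 - x ^+ 2 / 2 + x / 6
  | 3 => x ^+ 4 / 4 - x ^+ 3 / 2 + x ^+ 2 / 4
  | 4 => x ^+ 5 / 5 - x ^+ 4 / 2 + x ^+ 3 / 3 - x / 30
  | 5 => x ^+ 6 / 6 - x ^+ 5 / 2 + x ^+ 4 * 5 / 12 - x ^+ 2 / 12
  | 6 => x ^+ 7 / 7 - x ^+ 6 / 2 + x ^+ 5 / 2 - x ^+ 3 / 6 + x / 42
  | _ => x ^+ 8 / 8 - x ^+ 7 / 2 + x ^+ 6 * 7 / 12 - x ^+ 4 * 7 / 24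
         + x ^+ 2 / 12
  end.

Lemma power_sumS k x : (k <= 7)%N ->
  power_sum k (x + 1) - power_sum k x = x ^+ k.
Proof. by do 8![case: k => [|k]; first by move=> _ /=; field]. Qed.

Lemma sum_poly7 (c : nat -> rat) (d : nat) : (0 < d)%N ->
  \sum_(1 <= a < d) \sum_(0 <= j < 8) c j * a%:R ^+ j =
  \sum_(0 <= j < 8) c j * (power_sum j d%:R - power_sum j 1).
Proof.
move=> d_gt0; rewrite exchange_big; apply: eq_big_nat => j /= j_le7.
rewrite -mulr_sumr; congr (_ * _).
apply: (telescope_sumr_eq (fun a => power_sum j a%:R)) => // a _.
by rewrite -(power_sumS a%:R j_le7) natr1.
Qed.

(* Here [w] lists the coefficients of the left-hand side of quads_even_sum, and
   [e d] those, as a polynomial in [a], of the summand at [x = y], [a + b = d];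
   [q] lists the coefficients of its sum over [0 < a < d], as a polynomial in
   [d]. *)
Lemma sigma_conv_even_poly (g : rat -> rat -> rat) (c : rat) (k N : nat)
    (w q : nat -> rat) (e : rat -> nat -> rat) (n : nat) : (0 < n)%N ->
    (forall a b, g (- a) (- b) = g a b) ->
    (forall a b, g a b - g a (- b) + g a (a - b) - g a (a + b)
                 + g (b - a) b - g (a + b) b =
                 \sum_(0 <= i < N.+1) w i * (a ^+ i * b ^+ (N - i))) ->
    (forall a, g a a + g 0 a + g a 0 = c * a ^+ k.+1) ->
    (forall d a, g a (a - d) + g a d + g d (d - a) =
                 \sum_(0 <= j < 8) e d j * a ^+ j) ->
    (forall d, \sum_(0 <= j < 8) e d j * (power_sum j d - power_sum j 1) =
               \sum_(0 <= i < N.+2) q i * d ^+ i) ->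
  \sum_(0 <= i < N.+1) w i * sigma_conv i (N - i) n =
  c * (n%:R * sigmaQ k n - sigmaQ k.+1 n)
  - \sum_(0 <= i < N.+2) q i * sigmaQ i n.
Proof.
move=> n_gt0 g_even wE hE eE qE.
have /= := quads_even_sum n_gt0 g_even.
under eq_bigr do rewrite wE; rewrite exchange_big.
under [LHS]eq_bigr do rewrite -mulr_sumr -sigma_conv_quads.
move=> ->; rewrite sumrB -sum_codivisor_pow // mulr_sumr; congr (_ - _).
  by apply: eq_bigr => d _; rewrite hE mulrnAr.
under [RHS]eq_bigr do rewrite sigmaQE mulr_sumr; rewrite exchange_big /=.
rewrite big_seq [RHS]big_seq; apply: eq_bigr => d.
rewrite -dvdn_divisors // => dn.
rewrite -qE -sum_poly7 ?(dvdn_gt0 n_gt0 dn) //.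
by apply: eq_bigr => a _; rewrite eE.
Qed.

Lemma sigma_conv_1_1 n : (0 < n)%N ->
  12 * sigma_conv 1 1 n = 5 * sigmaQ 3 n + sigmaQ 1 n - 6 * n%:R * sigmaQ 1 n.
Proof.
move=> n_gt0.
have := @sigma_conv_even_poly (fun a b => a * b) 1 1 2
  (nth 0 [:: 0; - 2]) (nth 0 [:: 0; 1 / 6; - 1; 5 / 6])
  (fun d => nth 0 [:: d ^+ 2; - d; 1]) n n_gt0.
(* Expanding the sums over constant ranges makes the hypotheses of [sigma_conv_even_poly] plain
   polynomial identities. *)
rewrite /index_iota unlock /= => conv_eq.
have {conv_eq} := conv_eq ltac:(by move=> *; ring) ltac:(by move=> *; ring)
  ltac:(by move=> *; ring) ltac:(by move=> *; ring) ltac:(by move=> *; field).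
lra.
Qed.

Lemma sigma_conv_1_3 n : (0 < n)%N ->
  240 * sigma_conv 1 3 n =
  21 * sigmaQ 5 n + 10 * sigmaQ 3 n - 30 * n%:R * sigmaQ 3 n - sigmaQ 1 n.
Proof.
move=> n_gt0.
have := @sigma_conv_even_poly (fun a b => a ^+ 2 * b ^+ 2) 1 3 4
  (nth 0 [:: 0; - 4; 0; - 4])
  (nth 0 [:: 0; - 1 / 30; 0; 1 / 3; - 1; 7 / 10])
  (fun d => nth 0 [:: d ^+ 4; - 2 * d ^+ 3; 3 * d ^+ 2; - 2 * d; 1]) n n_gt0.
rewrite /index_iota unlock /= => conv_eq.
have {conv_eq} := conv_eq ltac:(by move=> *; ring) ltac:(by move=> *; ring)
  ltac:(by move=> *; ring) ltac:(by move=> *; ring) ltac:(by move=> *; field).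
rewrite (sigma_convC 3 1); lra.
Qed.

(** The weights in g give the two convolutions the ratio 84 : -400 (with 84 = 134 - 50), which is
    the ratio 24 * 504 : -240^2 found in P R - Q^2. The list [q] ends at degree 6, so no sigma_7
    appears. *)
Lemma sigma_conv_1_5_3_3 n : (0 < n)%N ->
  504 * sigma_conv 1 5 n - 2400 * sigma_conv 3 3 n =
  21 * sigmaQ 5 n + 20 * sigmaQ 3 n + sigmaQ 1 n - 42 * n%:R * sigmaQ 5 n.
Proof.
move=> n_gt0.
have := @sigma_conv_even_poly
  (fun a b => 23 * a * b ^+ 5 - 30 * a ^+ 3 * b ^+ 3) (- 7) 5 6
  (nth 0 [:: 0; 134; 0; - 400; 0; - 50])
  (nth 0 [:: 0; - 1 / 6; 0; - 10 / 3; 0; - 7 / 2; 7])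
  (fun d => nth 0 [:: - 7 * d ^+ 6; - 25 * d ^+ 5; 255 * d ^+ 4;
    - 430 * d ^+ 3; 255 * d ^+ 2; - 48 * d; - 7]) n n_gt0.
rewrite /index_iota unlock /= => conv_eq.
have {conv_eq} := conv_eq ltac:(by move=> *; ring) ltac:(by move=> *; ring)
  ltac:(by move=> *; ring) ltac:(by move=> *; ring) ltac:(by move=> *; field).
rewrite (sigma_convC 5 1); lra.
Qed.

(** As g(a, a) = 0, no term n sigma_7(n) arises, and the degree in a of the terms at x = y drops
    from 8 to 7. The convolutions of sigma_1 with sigma_7 cancel by symmetry. *)
Lemma sigma_conv_3_5 n : (0 < n)%N ->
  5040 * sigma_conv 3 5 n =
  11 * sigmaQ 9 n - 21 * sigmaQ 5 n + 10 * sigmaQ 3 n.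
Proof.
move=> n_gt0.
have := @sigma_conv_even_poly
  (fun a b => a ^+ 4 * b ^+ 4 - a ^+ 3 * b ^+ 5) 0 7 8
  (nth 0 [:: 0; - 2; 0; - 6; 0; 12; 0; 2])
  (nth 0 [:: 0; 0; 0; - 1 / 84; 0; 1 / 40; 0; 0; 0; - 11 / 840])
  (fun d => nth 0 [:: 0; d ^+ 7; - 4 * d ^+ 6; 6 * d ^+ 5; - 7 * d ^+ 4;
    7 * d ^+ 3; - 4 * d ^+ 2; d]) n n_gt0.
rewrite /index_iota unlock /= => conv_eq.
have {conv_eq} := conv_eq ltac:(by move=> *; ring) ltac:(by move=> *; ring)
  ltac:(by move=> *; ring) ltac:(by move=> *; ring) ltac:(by move=> *; field).
rewrite (sigma_convC 5 3) (sigma_convC 7 1); lra.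
Qed.

(** * The derivation q d/dq and congruences modulo powers of X *)

Definition theta (p : {poly rat}) : {poly rat} := 'X * p^`().

Lemma coef_theta p i : (theta p)`_i = i%:R * p`_i.
Proof.
by rewrite coefXM coef_deriv; case: i => [|i] /=; rewrite ?mul0r ?mulr_natl.
Qed.

Lemma thetaD p q : theta (p + q) = theta p + theta q.
Proof. by rewrite /theta derivD mulrDr. Qed.

Lemma thetaB p q : theta (p - q) = theta p - theta q.
Proof. by rewrite /theta derivB mulrBr. Qed.

Lemma thetaM p q : theta (p * q) = theta p * q + p * theta q.
Proof. by rewrite /theta derivM; ring. Qed.

Lemma thetaC c : theta c%:P = 0.
Proof. by rewrite /theta derivC mulr0. Qed.

Lemma theta_nat k : theta k%:R = 0.
Proof. by rewrite -polyC_natr thetaC. Qed.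

Lemma thetaX : theta 'X = 'X.
Proof. by rewrite /theta derivX mulr1. Qed.

Lemma theta_exp p k : theta (p ^+ k) = p ^+ k.-1 * theta p *+ k.
Proof. by rewrite /theta deriv_exp mulrnAr; congr (_ *+ _); ring. Qed.

Lemma dvdXnP (K : fieldType) M (p : {poly K}) :
  reflect (forall i, (i < M)%N -> p`_i = 0) ('X^M %| p).
Proof.
apply: (iffP (dvdpP p _)) => [[q ->] i iM|p0]; first by rewrite coefMXn iM.
exists (drop_poly M p); rewrite -[LHS](poly_take_drop M).
rewrite [take_poly _ _](_ : _ = 0) ?add0r //.
by apply/polyP => i; rewrite coef_take_poly coef0; case: ifP => // /p0.
Qed.

(** [theta] scales each coefficient, so unlike the plain derivative it loses no precision modulo
    ['X^M]. *)
Lemma dvdXn_theta M p : 'X^M %| p -> 'X^M %| theta p.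
Proof.
by move/dvdXnP=> p0; apply/dvdXnP => i iM; rewrite coef_theta p0 ?mulr0.
Qed.

(** The end terms are isolated because the Eisenstein series have constant term 1; the middle sum
    becomes the convolution proper. *)
Lemma coefM_ends (p q : {poly rat}) n : (0 < n)%N ->
  (p * q)`_n = p`_0 * q`_n + p`_n * q`_0 + \sum_(1 <= m < n) p`_m * q`_(n - m).
Proof.
case: n => // n _; rewrite coefM.
rewrite -(big_mkord xpredT (fun m => p`_m * q`_(n.+1 - m))).
rewrite big_nat_recl // subn0 big_nat_recr //= subnn.
by rewrite big_add1 /= addrA addrAC.
Qed.

(* Power series are represented by their truncations below degree M, and an
   identity between them by divisibility of the difference by 'X^M. *)
Definition eis (M : nat) (c : rat) (k : nat) : {poly rat} :=
  \poly_(i < M) if i == 0 then 1 else c * sigmaQ k i.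

Lemma coef0_eis M c k : (eis M.+1 c k)`_0 = 1.
Proof. by rewrite coef_poly. Qed.

Lemma coef_eis M c k i : (0 < i < M)%N -> (eis M c k)`_i = c * sigmaQ k i.
Proof. by case/andP=> i0 iM; rewrite coef_poly iM eqn0Ngt i0. Qed.

Lemma coef_eisM M c k d l i : (0 < i < M)%N ->
  (eis M c k * eis M d l)`_i =
  c * sigmaQ k i + d * sigmaQ l i + c * d * sigma_conv k l i.
Proof.
case: M => [|M]; first by rewrite ltn0 andbF.
move=> /[dup] i_bd /andP[i0 iM]; rewrite coefM_ends // !coef0_eis !coef_eis //.
rewrite mul1r mulr1 [X in X + _]addrC mulr_sumr; congr (_ + _).
apply: eq_big_nat => m /andP[m0 mi].
by rewrite !coef_eis; [ring|lia|lia].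
Qed.

(** * Ramanujan's differential equations and E_4 E_6 = E_10 for truncated series *)

Section Eisenstein.

Variable N : nat.

Local Notation P := (eis N.+1 (- 24) 1).
Local Notation Q := (eis N.+1 240 3).
Local Notation R := (eis N.+1 (- 504) 5).

Lemma ramanujan_P : 'X^(N.+1) %| 12 * theta P - (P ^+ 2 - Q).
Proof.
apply/dvdXnP => i iM; rewrite !coefB mulr_natl coefMn coef_theta expr2.
case: i iM => [|i] iM; first by rewrite coef0M !coef0_eis; ring.
have i_bd : (0 < i.+1 < N.+1)%N := iM.
rewrite (coef_eisM _ _ _ _ i_bd) !(coef_eis _ _ i_bd).
have := sigma_conv_1_1 (ltn0Sn i); lra.
Qed.

Lemma ramanujan_Q : 'X^(N.+1) %| 3 * theta Q - (P * Q - R).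
Proof.
apply/dvdXnP => i iM; rewrite !coefB mulr_natl coefMn coef_theta.
case: i iM => [|i] iM; first by rewrite coef0M !coef0_eis; ring.
have i_bd : (0 < i.+1 < N.+1)%N := iM.
rewrite (coef_eisM _ _ _ _ i_bd) !(coef_eis _ _ i_bd).
have := sigma_conv_1_3 (ltn0Sn i); lra.
Qed.

Lemma ramanujan_R : 'X^(N.+1) %| 2 * theta R - (P * R - Q ^+ 2).
Proof.
apply/dvdXnP => i iM; rewrite !coefB mulr_natl coefMn coef_theta expr2.
case: i iM => [|i] iM; first by rewrite !coef0M !coef0_eis; ring.
have i_bd : (0 < i.+1 < N.+1)%N := iM.
rewrite !(coef_eisM _ _ _ _ i_bd) !(coef_eis _ _ i_bd).
have := sigma_conv_1_5_3_3 (ltn0Sn i); lra.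
Qed.

Lemma eis4_mul_eis6 : 'X^(N.+1) %| Q * R - eis N.+1 (- 264) 9.
Proof.
apply/dvdXnP => i iM; rewrite !coefB.
case: i iM => [|i] iM; first by rewrite coef0M !coef0_eis mulr1 subrr.
have i_bd : (0 < i.+1 < N.+1)%N := iM.
rewrite (coef_eisM _ _ _ _ i_bd) !(coef_eis _ _ i_bd).
have := sigma_conv_3_5 (ltn0Sn i); lra.
Qed.

End Eisenstein.

(** * Formal consequences of Ramanujan's system *)

Section RamanujanSystem.

Variables (M : nat) (P Q R : {poly rat}).

Hypothesis ode_P : 'X^M %| 12 * theta P - (P ^+ 2 - Q).
Hypothesis ode_Q : 'X^M %| 3 * theta Q - (P * Q - R).
Hypothesis ode_R : 'X^M %| 2 * theta R - (P * R - Q ^+ 2).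

Lemma theta_discr : 'X^M %| theta (Q ^+ 3 - R ^+ 2) - P * (Q ^+ 3 - R ^+ 2).
Proof.
have -> : theta (Q ^+ 3 - R ^+ 2) - P * (Q ^+ 3 - R ^+ 2) =
    Q ^+ 2 * (3 * theta Q - (P * Q - R))
    - R * (2 * theta R - (P * R - Q ^+ 2)).
  by rewrite !exprS expr0 !mulr1 thetaB !thetaM; ring.
by rewrite dvdp_sub // dvdp_mull ?ode_Q ?ode_R.
Qed.

(** Half the first Rankin-Cohen bracket for weights 4 and 6; the terms P Q R cancel. *)
Lemma rankin_cohen1 :
  'X^M %| 2 * (Q * theta R) - 3 * (theta Q * R) + (Q ^+ 3 - R ^+ 2).
Proof.
have -> : 2 * (Q * theta R) - 3 * (theta Q * R) + (Q ^+ 3 - R ^+ 2) =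
    Q * (2 * theta R - (P * R - Q ^+ 2)) - R * (3 * theta Q - (P * Q - R)).
  by ring.
by rewrite dvdp_sub // dvdp_mull ?ode_Q ?ode_R.
Qed.

(** The second Rankin-Cohen bracket for weights 4 and 6, with coefficients C(5,2), -C(5,1) C(7,1)
    and C(7,2). *)
Lemma rankin_cohen2 :
  'X^M %| 10 * (Q * theta (theta R)) - 35 * (theta Q * theta R)
          + 21 * (theta (theta Q) * R).
Proof.
set B := (X in _ %| X).
pose eP := 12 * theta P - (P ^+ 2 - Q); pose eQ := 3 * theta Q - (P * Q - R).
pose eR := 2 * theta R - (P * R - Q ^+ 2).
(* The factor 6 clears the denominators of [theta Q] and [theta R]. In the combination below, the
   first two terms produce the second derivatives, [eP] removes the resulting [theta P], and the
   rest removes the first derivatives of Q and R. *)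
have : 'X^M %| 6 * B.
  have -> : 6 * B = 30 * Q * theta eR + 42 * R * theta eQ + 6 * Q * R * eP
      + (15 * P * Q - 21 * R - 105 * theta Q) * eR
      + (14 * P * R - 20 * Q ^+ 2 - 35 * (P * R - Q ^+ 2)) * eQ.
    rewrite /eP /eQ /eR /B !expr2 !thetaB !thetaM !theta_nat; ring.
  by rewrite !dvdp_add // dvdp_mull ?dvdXn_theta ?ode_P ?ode_Q ?ode_R.
by rewrite -polyC_natr mul_polyC dvdpZr.
Qed.

End RamanujanSystem.

(** * The product Delta and its first order equation *)

Lemma theta_eqn_uniq M (P G : {poly rat}) :
  P`_0 = 1 -> G`_1 = 0 -> 'X^M %| theta G - P * G -> 'X^M %| G.
Proof.
move=> P0 G1 /dvdXnP odeG; apply/dvdXnP => n.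
elim/ltn_ind: n => n IHn nM; have [->//|n_neq1] := eqVneq n 1%N.
(* The coefficient of degree n reads (n - 1) G_n = sum of P_i G_(n-i) over i > 0, which vanishes by
   induction; only n = 1 escapes, and there [G1] serves. *)
have := odeG n nM; rewrite coefB coef_theta coefM big_ord_recl P0 subn0 mul1r.
rewrite big1 => [|i _]; last first.
  by rewrite lift0 IHn ?mulr0 //; have := ltn_ord i; lia.
rewrite addr0 -{2}[G`_n]mul1r -mulrBl => /eqP; rewrite mulf_eq0 subr_eq0.
by rewrite (eqr_nat _ _ 1) (negPf n_neq1) => /eqP.
Qed.

Definition deltaQ (N : nat) : {poly rat} :=
  'X * \prod_(1 <= m < N.+1) (1 - 'X^m) ^+ 24.

Lemma deltaQE N : deltaQ N = map_poly intr (delta_partial N).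
Proof.
rewrite /delta_partial rmorphM /= map_polyX rmorph_prod; congr (_ * _).
by apply: eq_bigr => m _; rewrite rmorphXn rmorphB rmorph1 /= map_polyXn.
Qed.

Lemma coef_deltaQ n N : (n <= N)%N -> (deltaQ N)`_n = (tau n)%:Q.
Proof. by move=> nN; rewrite deltaQE coef_map /= tau_delta_partial. Qed.

(* Truncation of m X^m / (1 - X^m), the logarithmic derivative of 1 - X^m up to
   sign. *)
Definition lambert_term (M m : nat) : {poly rat} :=
  \poly_(i < M) if (0 < i)%N && (m %| i)%N then m%:R else 0.

(** Multiplication by 1 - X^m telescopes: m divides i iff it divides i - m, so beyond degree m
    everything cancels, and degree m leaves m X^m, offset by [theta]. *)
Lemma theta_1subXn M m : (0 < m)%N ->
  'X^M %| theta (1 - 'X^m) + (1 - 'X^m) * lambert_term M m.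
Proof.
move=> m_gt0; apply/dvdXnP => i iM.
rewrite coefD coef_theta mulrBl mul1r !coefB coefXnM !coef_poly coef1 coefXn iM.
case: i iM => [|i] iM; first by rewrite m_gt0 /= mul0r add0r subr0.
rewrite (leq_ltn_trans (leq_subr _ _) iM) /= sub0r; have [lt_im|] := ltnP.
  by rewrite gtnNdvd // (ltn_eqF lt_im) /= mulr0n; ring.
rewrite leq_eqVlt => /predU1P[<-|lt_mi].
  by rewrite subnn dvdnn eqxx subr0 mulr1n mulrN1 addNr.
rewrite subn_gt0 lt_mi (gtn_eqF lt_mi) dvdn_subl ?(ltnW lt_mi) ?dvdnn //=.
by rewrite mulr0n oppr0 mulr0 add0r subrr.
Qed.

Lemma sum_lambert_term N :
  1 - 24 * \sum_(1 <= m < N.+1) lambert_term N.+1 m = eis N.+1 (- 24) 1.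
Proof.
apply/polyP => i; rewrite coefB coef1 mulr_natl coefMn coef_sum coef_poly.
under eq_bigr do rewrite coef_poly.
have [iN|leNi] := ltnP; last first.
  by rewrite big1 // mul0rn subr0; case: i leNi.
case: i iN => [|i] iN /=; first by rewrite big1 // mul0rn subr0.
rewrite sub0r -big_mkcond /= mulNr mulr_natl sigmaQE; congr (- (_ *+ _)).
apply: (big_bij_seq id id (fun d => d%:R ^+ 1));
  rewrite ?iota_uniq ?divisors_uniq //.
  by move=> d _ dn; rewrite -dvdn_divisors.
move=> d; rewrite -dvdn_divisors // => dn _; split=> //.
by rewrite mem_index_iota (dvdn_gt0 _ dn) // (leq_ltn_trans (dvdn_leq _ dn)).
Qed.

Lemma theta_delta N :
  'X^(N.+1) %| theta (deltaQ N) - eis N.+1 (- 24) 1 * deltaQ N.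
Proof.
rewrite -sum_lambert_term /deltaQ.
(* The number K of factors varies while the precision N + 1 stays fixed: X has logarithmic
   derivative 1, and each new factor contributes -24 times its Lambert term. *)
suff: forall K, 'X^(N.+1) %|
    theta ('X * \prod_(1 <= m < K.+1) (1 - 'X^m) ^+ 24)
    - (1 - 24 * \sum_(1 <= m < K.+1) lambert_term N.+1 m)
      * ('X * \prod_(1 <= m < K.+1) (1 - 'X^m) ^+ 24) by [].
elim=> [|K IHK].
  by rewrite !big_nil mulr1 mulr0 subr0 mul1r thetaX subrr dvdp0.
rewrite !(big_nat_recr K.+1) //=; set E := \prod_(_ <= _ < _) _ in IHK *.
set S := \sum_(_ <= _ < _) _ in IHK *.
set L := lambert_term _ _; set a := 1 - 'X^_.
have -> : theta ('X * (E * a ^+ 24))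
    - (1 - 24 * (S + L)) * ('X * (E * a ^+ 24)) =
    a ^+ 24 * (theta ('X * E) - (1 - 24 * S) * ('X * E)) +
    24 * a ^+ 23 * 'X * E * (theta a + a * L).
  have theta_a : theta (a ^+ 24) = 24 * a ^+ 23 * theta a.
    by rewrite theta_exp; ring.
  by rewrite mulrA thetaM theta_a; ring.
by rewrite dvdp_add // dvdp_mull // theta_1subXn.
Qed.

(** Delta has coefficient 1 at X, so subtracting G_1 Delta leaves a solution with vanishing
    coefficient at X, to which [theta_eqn_uniq] applies. *)
Lemma theta_eqn_delta N (G : {poly rat}) : (0 < N)%N ->
  'X^(N.+1) %| theta G - eis N.+1 (- 24) 1 * G ->
  'X^(N.+1) %| G - G`_1 *: deltaQ N.
Proof.
move=> N_gt0 odeG; apply: (theta_eqn_uniq (P := eis N.+1 (- 24) 1)).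
- exact: coef0_eis.
- have tau1 : tau 1 = 1.
    rewrite /tau /delta_partial big_nat1 coefXM -horner_coef0.
    by rewrite !hornerE expr1n.
  by rewrite coefB coefZ coef_deltaQ // tau1 mulr1 subrr.
set P := eis _ _ _ in odeG *; set D := deltaQ N; rewrite -mul_polyC.
have -> : theta (G - (G`_1)%:P * D) - P * (G - (G`_1)%:P * D) =
    theta G - P * G - (G`_1)%:P * (theta D - P * D).
  by rewrite thetaB thetaM thetaC; ring.
by rewrite dvdp_sub // dvdp_mull // theta_delta.
Qed.

Lemma coef1_cube_sub_square (q r : {poly rat}) :
  q`_0 = 1 -> r`_0 = 1 -> (q ^+ 3 - r ^+ 2)`_1 = 3 * q`_1 - 2 * r`_1.
Proof.
move=> q0 r0; have coef1M (a b : {poly rat}) :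
    (a * b)`_1 = a`_0 * b`_1 + a`_1 * b`_0.
  by rewrite coefM_ends // big_geq // addr0.
by rewrite coefB exprS !expr2 !coef1M coef0M q0 r0; ring.
Qed.

(** Here 1728 = 3 * 240 + 2 * 504. *)
Lemma coef1_discr N : (0 < N)%N ->
  (eis N.+1 240 3 ^+ 3 - eis N.+1 (- 504) 5 ^+ 2)`_1 = 1728.
Proof.
move=> N_gt0; have coef1_eis c k : (eis N.+1 c k)`_1 = c.
  by rewrite coef_eis // sigmaQE big_seq1 expr1n mulr1.
rewrite coef1_cube_sub_square; [|exact: coef0_eis|exact: coef0_eis].
rewrite !coef1_eis; ring.
Qed.

Lemma coef_discr n : (0 < n)%N ->
  (eis n.+1 240 3 ^+ 3 - eis n.+1 (- 504) 5 ^+ 2)`_n = 1728 * (tau n)%:Q.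
Proof.
move=> n_gt0; rewrite -(coef1_discr n_gt0).
have odeF := theta_discr (ramanujan_Q n) (ramanujan_R n).
have /dvdXnP/(_ n (ltnSn n)) := theta_eqn_delta n_gt0 odeF.
by rewrite coefB coefZ coef_deltaQ // => /subr0_eq.
Qed.

(** * Extraction of coefficients and the concluding linear algebra *)

Lemma coef_iter_theta r p i : (iter r theta p)`_i = i%:R ^+ r * p`_i.
Proof.
by elim: r => [|r IHr]; rewrite ?mul1r //= coef_theta IHr exprS mulrA.
Qed.

(** The factors [0 ^+ r] and [0 ^+ s] are the constant terms of the differentiated series: 1 without
    differentiation, 0 otherwise. *)
Lemma coef_iter_thetaM_eis M c d k l r s n : (0 < n < M)%N ->
  (iter r theta (eis M c k) * iter s theta (eis M d l))`_n =
  0 ^+ r * n%:R ^+ s * d * sigmaQ l n + 0 ^+ s * n%:R ^+ r * c * sigmaQ k n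
  + c * d * \sum_(1 <= m < n)
      m%:R ^+ r * (n%:R - m%:R) ^+ s * sigmaQ k m * sigmaQ l (n - m).
Proof.
case: M => [|M]; first by rewrite ltn0 andbF.
move=> /[dup] n_bd /andP[n0 nM]; rewrite coefM_ends // !coef_iter_theta.
rewrite !coef0_eis !coef_eis // mulr_sumr; congr (_ + _); first by ring.
apply: eq_big_nat => m /andP[m0 mn]; rewrite !coef_iter_theta.
by rewrite !coef_eis ?natrB ?(ltnW mn) //; [ring|lia|lia].
Qed.

Theorem theorem2p2 (n : nat) (n_ge1 : (1 <= n)%N) :
  [/\ (tau n)%:Q =
        - (11%:R / 24%:R) * n%:R * (sigma 9 n)%:R
        + 35%:R / 24%:R * n%:R * (sigma 5 n)%:R
        + 350%:R * \sum_(1 <= m < n)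
            (n%:R - m%:R) * (sigma 3 m)%:R * (sigma 5 (n - m))%:R,
      (tau n)%:Q =
        11%:R / 36%:R * n%:R * (sigma 9 n)%:R
        + 25%:R / 36%:R * n%:R * (sigma 3 n)%:R
        - 350%:R * \sum_(1 <= m < n)
            m%:R * (sigma 3 m)%:R * (sigma 5 (n - m))%:R,
      (tau n)%:Q =
        1 / 6%:R * n%:R * (sigma 9 n)%:R
        + 5%:R / 6%:R * n%:R * (sigma 3 n)%:R
        - 420%:R / n%:R * \sum_(1 <= m < n)
            m%:R ^+ 2 * (sigma 3 m)%:R * (sigma 5 (n - m))%:R,
      (tau n)%:Q =
        n%:R * (sigma 9 n)%:R
        - 2100%:R / n%:R * \sum_(1 <= m < n)
            m%:R * (n%:R - m%:R) * (sigma 3 m)%:R * (sigma 5 (n - m))%:R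
    & (tau n)%:Q =
        - (1 / 4%:R) * n%:R * (sigma 9 n)%:R
        + 5%:R / 4%:R * n%:R * (sigma 5 n)%:R
        + 300%:R / n%:R * \sum_(1 <= m < n)
            (n%:R - m%:R) ^+ 2 * (sigma 3 m)%:R * (sigma 5 (n - m))%:R].
Proof.
pose Q := eis n.+1 240 3; pose R := eis n.+1 (- 504) 5.
pose E := eis n.+1 (- 264) 9; pose F := Q ^+ 3 - R ^+ 2.
pose c r s := (iter r theta Q * iter s theta R)`_n.
pose T r s := \sum_(1 <= m < n)
  m%:R ^+ r * (n%:R - m%:R) ^+ s * sigmaQ 3 m * sigmaQ 5 (n - m).
have cE r s : c r s = 0 ^+ r * n%:R ^+ s * (- 504) * sigmaQ 5 n
    + 0 ^+ s * n%:R ^+ r * 240 * sigmaQ 3 n + 240 * (- 504) * T r s.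
  by rewrite /c coef_iter_thetaM_eis ?n_ge1 /=.
have En : E`_n = - 264 * sigmaQ 9 n by rewrite coef_eis ?n_ge1 /=.
have coef_eq (p : {poly rat}) : 'X^(n.+1) %| p -> p`_n = 0.
  by move/dvdXnP => p0; apply: p0.
have Fn : F`_n = 1728 * (tau n)%:Q := coef_discr n_ge1.
have eqE : 'X^(n.+1) %| Q * R - E := eis4_mul_eis6 n.
have eqF : 'X^(n.+1) %| 2 * (Q * theta R) - 3 * (theta Q * R) + F.
  exact: rankin_cohen1 (ramanujan_Q n) (ramanujan_R n).
have eqB : 'X^(n.+1) %| 10 * (Q * theta (theta R)) - 35 * (theta Q * theta R)
    + 21 * (theta (theta Q) * R).
  exact: rankin_cohen2 (ramanujan_P n) (ramanujan_Q n) (ramanujan_R n).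
clearbody F E Q R.
(* [lin1] and [lin2] determine [c 0 1] and [c 1 0] from n sigma_9(n) and tau(n), which gives (i) and
   (ii). *)
have lin1 : c 1 0 + c 0 1 = n%:R * E`_n.
  have := coef_eq _ (dvdXn_theta eqE).
  by rewrite thetaB thetaM coefB coefD coef_theta => /subr0_eq.
have lin2 : 2 * c 0 1 - 3 * c 1 0 + F`_n = 0.
  by rewrite -[RHS](coef_eq _ eqF) coefD coefB !mulr_natl !coefMn.
(* Three independent equations for the three coefficients of second order: D^2 (Q R) = D^2 E, the
   derivative of the first bracket, and the second bracket. They give (iii), (iv) and (v). *)
have quad1 : c 2 0 + 2 * c 1 1 + c 0 2 = n%:R ^+ 2 * E`_n.
  have := coef_eq _ (dvdXn_theta (dvdXn_theta eqE)).
  rewrite 2!thetaB (thetaM Q R) thetaD.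
  rewrite (thetaM (theta Q) R) (thetaM Q (theta R)) coefB !coefD.
  rewrite (coef_theta (theta E)) (coef_theta E) /c /=; lra.
have quad2 : 2 * c 0 2 - c 1 1 - 3 * c 2 0 + n%:R * F`_n = 0.
  have := coef_eq _ (dvdXn_theta eqF).
  rewrite thetaD thetaB (thetaM 2) (thetaM 3) !theta_nat !mul0r !add0r.
  rewrite (thetaM (theta Q) R) (thetaM Q (theta R)) coefD coefB.
  rewrite !mulr_natl !coefMn !coefD (coef_theta F) /c /=; lra.
have quad3 : 10 * c 0 2 - 35 * c 1 1 + 21 * c 2 0 = 0.
  by rewrite -[RHS](coef_eq _ eqB) coefD coefB !mulr_natl !coefMn.
have n_neq0 : n%:R != 0 :> rat by rewrite pnatr_eq0 -lt0n.
(* The second order equations contain tau(n) only multiplied by n; dividing at the end leaves goals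
   that [lra] can solve. *)
have tau_div x : n%:R * (tau n)%:Q = x -> (tau n)%:Q = x / n%:R.
  by move=> <-; rewrite mulrC mulKf.
rewrite -[(sigma 9 n)%:R]/(sigmaQ 9 n) -[(sigma 5 n)%:R]/(sigmaQ 5 n).
rewrite -[(sigma 3 n)%:R]/(sigmaQ 3 n).
have -> : \sum_(1 <= m < n)
    (n%:R - m%:R) * (sigma 3 m)%:R * (sigma 5 (n - m))%:R = T 0 1.
  by apply: eq_bigr => m _; rewrite expr0 expr1 mul1r.
have -> : \sum_(1 <= m < n)
    m%:R * (sigma 3 m)%:R * (sigma 5 (n - m))%:R = T 1 0.
  by apply: eq_bigr => m _; rewrite expr0 expr1 mulr1.
have -> : \sum_(1 <= m < n)
    m%:R ^+ 2 * (sigma 3 m)%:R * (sigma 5 (n - m))%:R = T 2 0.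
  by apply: eq_bigr => m _; rewrite expr0 mulr1.
have -> : \sum_(1 <= m < n)
    m%:R * (n%:R - m%:R) * (sigma 3 m)%:R * (sigma 5 (n - m))%:R = T 1 1.
  by apply: eq_bigr => m _; rewrite !expr1.
have -> : \sum_(1 <= m < n)
    (n%:R - m%:R) ^+ 2 * (sigma 3 m)%:R * (sigma 5 (n - m))%:R = T 0 2.
  by apply: eq_bigr => m _; rewrite expr0 mul1r.
rewrite En Fn !cE in lin1 lin2 quad1 quad2 quad3.
clearbody T; clear c cE.
split.
- lra.
- lra.
- rewrite (tau_div (1 / 6 * n%:R ^+ 2 * sigmaQ 9 n
    + 5 / 6 * n%:R ^+ 2 * sigmaQ 3 n - 420 * T 2 0)); [by field | lra].
- rewrite (tau_div (n%:R ^+ 2 * sigmaQ 9 n - 2100 * T 1 1)); [by field | lra].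
- rewrite (tau_div (- (1 / 4) * n%:R ^+ 2 * sigmaQ 9 n
    + 5 / 4 * n%:R ^+ 2 * sigmaQ 5 n + 300 * T 0 2)); [by field | lra].
Qed.
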